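(* For every $\alpha>0$ and every positive integer $d$ there is a constant $C(\alpha,d)>0$, depending only on $\alpha$ and $d$, such that the following holds. Let $\Gamma$ be a finite $\alpha$-expander graph of degree $\le d$ with $|V|=N$ vertices. Then its intrinsic distortion with respect to embeddings into $\mathbb{R}^3$ satisfies $$D_3(\Gamma)>C(\alpha,d)\,N^{1/2}.$$
   Context: A finite graph $\Gamma$ with vertex set $V$ is an $\alpha$-expander if whenever $S\subset V$ is a set of vertices with $|S|\le|V|/2$, the number of edges connecting vertices in $S$ to vertices in $V\smallsetminus S$ is at least $\alpha|S|$. ''Degree $\le d$'' means that each vertex has degree at most $d$. For a subset $K\subset\mathbb{R}^m$ and $x,y\in K$, let $d_K(x,y)$ be the intrinsic metric: the infimum of the lengths of paths in $K$ connecting $x$ and $y$. The distortion of $K$ is $$\delta(K)=\sup_{x,y\in K,\;x\ne y}\frac{d_K(x,y)}{d_{\mathbb{R}^m}(x,y)}.$$ The intrinsic distortion of a complex $K$ with respect to embeddings in $\mathbb{R}^m$ is $D_m(K)=\inf_i\delta(i(K))$, where the infimum is over all embeddings $i:K\hookrightarrow\mathbb{R}^m$. For a graph $\Gamma$ the distortion is measured on the entire graph viewed as a $1$-complex (including its edges), not just on the vertex set. *)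

(* Defs.v *)
From HB Require Import structures.
From mathcomp Require Import all_boot all_order all_algebra.
From mathcomp Require Import all_classical all_reals all_analysis.

Set Implicit Arguments.
Unset Strict Implicit.
Unset Printing Implicit Defensive.

Import Order.TTheory GRing.Theory Num.Theory.
Import numFieldNormedType.Exports.

Local Open Scope ring_scope.

(* A finite simple graph is a symmetric irreflexive relation e on the finite
   type V of its vertices. *)
Section graph.
Context {R : realType} {V : finType}.
Implicit Types (e : rel V) (v : V) (S : {set V}).

Definition degree e v : nat := #|[pred w | e v w]|.

(* Orienting an edge between S and its complement from S outwards, each such
   edge is counted exactly once. *)
Definition edge_boundary e S : {set V * V} :=
  finset (fun p : V * V => [&& p.1 \in S, p.2 \notin S & e p.1 p.2]).

Definition expander (alpha : R) e : Prop :=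
  forall S, #|S|%:R <= #|V|%:R / 2 :> R ->
    alpha * #|S|%:R <= #|edge_boundary e S|%:R.

Local Open Scope classical_set_scope.

(* The 1-dimensional simplicial complex of the graph, in barycentric
   coordinates: each point lies in the closed simplex spanned by some u and v,
   a vertex if u = v and an edge otherwise. *)
Definition realization e : set {ptws V -> R} :=
  [set x | [/\ forall v, 0 <= x v, \sum_v x v = 1 &
     exists u v, (u = v \/ e u v) /\ forall w, x w != 0 -> w = u \/ w = v]].

End graph.

Arguments realization R {V} e.

Local Open Scope classical_set_scope.

Section distortion.
Context {R : realType} {m : nat}.
Implicit Types (x y : 'rV[R]_m) (g : R -> 'rV[R]_m) (K : set 'rV[R]_m).

(* The norm `|x - y| of the library on 'rV[R]_m is the sup norm. *)
Definition euclidean_dist x y : R :=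
  Num.sqrt (\sum_(i < m) (x ord0 i - y ord0 i) ^+ 2).

(* The length of the polygon inscribed in g on [0, 1] at 0 :: s. *)
Definition polygon_length g (s : seq R) : R :=
  \sum_(i < size s)
    euclidean_dist (g (nth 0 (0 :: s) i)) (g (nth 0 (0 :: s) i.+1)).

Definition path_length g : \bar R :=
  ereal_sup [set (polygon_length g s)%:E | s in itv_partition 0 1].

Definition paths_in K x y : set (R -> 'rV[R]_m) :=
  [set g : R -> 'rV[R]_m |
     [/\ {within `[0, 1 : R], continuous g}, g 0 = x, g 1 = y &
         forall t : R, 0 <= t <= 1 -> K (g t)]].

Definition intrinsic_dist K x y : \bar R :=
  ereal_inf [set path_length g | g in paths_in K x y].

(* Every quotient below is at least 1, so the supremum is taken in [1, +oo]:
   the extra element 1 only matters if K has at most one point, and then the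
   distortion is 1. *)
Definition distortion K : \bar R :=
  ereal_sup (1%E |` [set (intrinsic_dist K p.1 p.2 *
                            ((euclidean_dist p.1 p.2)^-1)%:E)%E
                    | p in [set p | [/\ K p.1, K p.2 & p.1 <> p.2]]]).

End distortion.

Definition embedding {T U : topologicalType} (K : set T) (f : T -> U) : Prop :=
  {within K, continuous f} /\
  exists2 g : U -> T, {within f @` K, continuous g} & {in K, cancel f g}.

Definition intrinsic_distortion {R : realType} (m : nat) {T : topologicalType}
    (K : set T) : \bar R :=
  ereal_inf [set distortion (f @` K)
            | f in [set f : T -> 'rV[R]_m | embedding K f]].

(* Main.v *)
Require Import Defs.
From mathcomp Require Import all_boot all_order all_algebra.
From mathcomp Require Import all_classical all_reals all_analysis.
From mathcomp Require Import ring lra.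

Set Implicit Arguments.
Unset Strict Implicit.
Unset Printing Implicit Defensive.

Import Order.TTheory GRing.Theory Num.Theory.
Import numFieldNormedType.Exports.

Local Open Scope ring_scope.
Local Open Scope classical_set_scope.

(** Let f embed an expander with N vertices in space with distortion delta.
Distances are measured in the sup norm, so that balls are cubes; this changes
lengths only by bounded factors.

Among the cubes centred at a vertex that contain a fixed small fraction of the
vertices, take one of minimal half-side r. The cube of half-side 2r is covered
by boundedly many cubes of diameter smaller than r, none of which holds that
fraction, so it contains at most half of the vertices ([doubling_ball]). For
every s in [r, 2r] the cube of half-side s is therefore a set of vertices to
which the expansion property applies, and at least c N edges, with
c = c(alpha), run from inside this cube to outside it; each of them meets the
boundary of the cube ([edge_crosses_sphere]).

The boundary of the cube is two-dimensional, so it splits into about k^2 cells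
of diameter about r / k. Two points of different edges in a common cell are
joined inside the image by a path of length at most about delta r / k, and this
path can leave the first edge only through one of its ends ([edge_exit],
[near_endpoint]). Hence all but one edge of each cell have an end within
b ~ delta r / k of the boundary. If k^2 is a small multiple of N, then k^2 is
still below c N / 2, so, the degrees being at most d, at least about c N / d
vertices lie in the shell of width 2b around the boundary
([card_boundary_le_annulus]).

If delta were a small enough multiple of N^(1/2), the shells would be so thin
that more than d / c disjoint ones fit between r and 2r, and together they would
contain more than N vertices ([distortion_gt_of_expander]). Small N are covered
by the trivial bound delta >= 1. *)

(** * Continuity in function spaces and on subspaces *)

Lemma ptws_cvg (U : Type) (V : topologicalType) (F : set_system {ptws U -> V})
    (f : {ptws U -> V}) :
  Filter F -> (forall t, g t @[g --> F] --> f t) -> F --> f.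
Proof.
move=> FF cvgF; rewrite cvg_sup => i; rewrite cvg_image.
  move=> W /= /(cvgF i) Wi; exists (@^~ i @^-1` W) => //.
  by rewrite eqEsubset; split=> [j [? + <-//]|j Wj]; exists (fun _ => j).
by rewrite eqEsubset; split => // v _; exists (fun=> v).
Qed.

Lemma within_continuousT (U V W : topologicalType) (A : set U) (B : set V)
    (g : U -> V) (f : V -> W) :
  {within A, continuous g} -> (forall x, A x -> B (g x)) ->
  {within B, continuous f} -> {within A, continuous (f \o g)}.
Proof.
move=> /subspace_continuousP cg AB /subspace_continuousP cf.
apply/subspace_continuousP => x Ax.
apply: (@cvg_comp _ _ _ g f _ (within B (nbhs (g x)))).
  move=> P /(cg _ Ax); rewrite /fmap /= /within /=.
  by apply: filterS2 (withinT A (nbhs_filter x)) => y Ay; apply=> //; exact: AB.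
exact: cf (AB _ Ax).
Qed.

(** * Norms, lengths and distortion in coordinates *)

Section euclid.
Context {R : realType} {m : nat}.
Implicit Types x y : 'rV[R]_m.

Lemma coord_le_norm x j : `|x ord0 j| <= `|x|.
Proof. by rewrite /Num.norm /= mx_normrE; exact: (le_bigmax _ _ (ord0, j)). Qed.

Lemma norm_le_coord x (c : R) : 0 <= c -> (forall j, `|x ord0 j| <= c) -> `|x| <= c.
Proof.
move=> c0 xc; rewrite /Num.norm /= mx_normrE; apply: bigmax_le => // -[i j] _ /=.
by rewrite ord1.
Qed.

Lemma norm_coordE x : 0 < `|x| -> exists j, `|x| = `|x ord0 j|.
Proof.
move=> /lt0r_neq0/mx_norm_neq0[[i j] /= xE]; exists j.
by rewrite [LHS]xE ord1.
Qed.

Lemma norm_le_euclid x y : `|x - y| <= euclidean_dist x y.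
Proof.
apply: norm_le_coord => [|j]; first exact: sqrtr_ge0.
rewrite -sqrtr_sqr ler_sqrt ?sumr_ge0// => [|i _]; last exact: sqr_ge0.
rewrite (bigD1 j)//= !mxE lerDl sumr_ge0// => i _; exact: sqr_ge0.
Qed.

Lemma euclid_le_norm x y : euclidean_dist x y <= m%:R * `|x - y|.
Proof.
rewrite -[leRHS]ger0_norm ?mulr_ge0// -sqrtr_sqr ler_wsqrtr//.
apply: (@le_trans _ _ (\sum_(i < m) `|x - y| ^+ 2)).
  apply: ler_sum => i _; rewrite -[leLHS]real_normK ?num_real//.
  rewrite lerXn2r ?nnegrE//; have := coord_le_norm (x - y) i.
  by rewrite !mxE.
rewrite sumr_const card_ord -[leLHS]mulr_natl exprMn ler_wpM2r ?sqr_ge0//.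
by rewrite -natrX ler_nat; case: m => // n; rewrite leq_pmulr.
Qed.

(** Inscribe the polygon with vertices at times 0, t and 1. *)
Lemma path_length_ge (g : R -> 'rV[R]_m) t : 0 <= t <= 1 ->
  ((euclidean_dist (g 0) (g t))%:E <= path_length g)%E.
Proof.
move=> /andP[t0 t1].
have e0 (u v : 'rV[R]_m) : 0 <= euclidean_dist u v by exact: sqrtr_ge0.
have poly s : itv_partition 0 1 s -> ((polygon_length g s)%:E <= path_length g)%E.
  by move=> ps; apply: ereal_sup_ubound; exists s.
(* A partition is strictly increasing, so t = 0 and t = 1 cannot be inserted
   in it and are treated apart. *)
have [t00|tn0] := eqVneq t 0.
  rewrite t00; apply: (@le_trans _ _ 0%E).
    rewrite lee_fin /euclidean_dist big1 ?sqrtr0// => i _.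
    by rewrite subrr expr0n.
  apply: le_trans (poly [:: 1] _); last by split => //=; rewrite ltr01.
  by rewrite lee_fin sumr_ge0.
have [->|tn1] := eqVneq t 1.
  apply: le_trans (poly [:: 1] _); last by split => //=; rewrite ltr01.
  by rewrite lee_fin /polygon_length /= big_ord_recl big_ord0 addr0.
apply: le_trans (poly [:: t; 1] _).
  by rewrite lee_fin /polygon_length /= !big_ord_recl big_ord0 addr0 lerDl.
by split => //=; rewrite !lt_neqAle eq_sym tn0 t0 tn1 t1.
Qed.

(** The form in which a bound on the distortion is used: a near-optimal path
    from x to y is so short that it stays close to x. *)
Lemma short_path (K : set 'rV[R]_m) x y (D b : R) :
  (distortion K <= D%:E)%E -> K x -> K y -> x <> y ->
  D * euclidean_dist x y < b ->
  exists2 g, paths_in K x y g & forall t, 0 <= t <= 1 -> `|g t - x| < b.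
Proof.
move=> KD Kx Ky xy Db.
have exy : 0 < euclidean_dist x y.
  apply: lt_le_trans (norm_le_euclid x y).
  by rewrite normr_gt0 subr_eq0; apply/eqP.
have : (intrinsic_dist K x y * ((euclidean_dist x y)^-1)%:E <= D%:E)%E.
  apply: le_trans KD; apply: ereal_sup_ubound; right.
  by exists (x, y).
rewrite lee_pdivrMr// -EFinM => dxy.
have /ereal_inf_lt[_ [g gp <-] gb] : (intrinsic_dist K x y < b%:E)%E.
  exact: le_lt_trans dxy _.
exists g => // t /(path_length_ge g) tl.
case: gp => _ g0 _ _.
rewrite distrC; apply: le_lt_trans (norm_le_euclid _ _) _.
by rewrite -lte_fin -{1}g0; exact: le_lt_trans tl gb.
Qed.

End euclid.

Lemma distortion_ge1 (R : realType) m (K : set 'rV[R]_m) : (1 <= distortion K)%E.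
Proof. by apply: ereal_sup_ubound; left. Qed.

(** * The realization of a graph *)

Section realization.
Context {R : realType} {V : finType}.
Implicit Types (e : rel V) (u v w : V).

Definition vertex v : {ptws V -> R} := fun u => (u == v)%:R.

Definition edge_point v w (t : R) : {ptws V -> R} :=
  fun u => (1 - t) * (u == v)%:R + t * (u == w)%:R.

Lemma edge_point0 v w : edge_point v w 0 = vertex v.
Proof. by apply/funext => u; rewrite /edge_point subr0 mul1r mul0r addr0. Qed.

Lemma edge_point1 v w : edge_point v w 1 = vertex w.
Proof. by apply/funext => u; rewrite /edge_point subrr mul0r add0r mul1r. Qed.

Lemma vertex_inj : injective vertex.
Proof.
move=> v w /(congr1 (fun x => x v)); rewrite /vertex eqxx.
by case: eqVneq => // _ /eqP; rewrite oner_eq0.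
Qed.

Lemma sum_vertex v : \sum_u vertex v u = 1.
Proof.
rewrite (bigD1 v)//= /vertex eqxx big1 ?addr0// => u /negbTE.
by move=> ->.
Qed.

Lemma edge_point_realization e v w t : v = w \/ e v w -> 0 <= t <= 1 ->
  realization R e (edge_point v w t).
Proof.
move=> vw /andP[t0 t1]; split.
- by move=> u; rewrite addr_ge0// mulr_ge0// subr_ge0.
- rewrite big_split /= -!mulr_sumr -/(vertex v _).
  by have /= := sum_vertex v; have /= := sum_vertex w; rewrite /vertex => -> ->; ring.
- exists v, w; split => // u; rewrite /edge_point.
  have [->|_] := eqVneq u v; first by left.
  have [->|_] := eqVneq u w; first by right.
  by rewrite !mulr0 addr0 eqxx.
Qed.

Lemma vertex_realization e v : realization R e (vertex v).
Proof.
rewrite -(edge_point0 v v); apply: edge_point_realization; first by left.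
by rewrite lexx ler01.
Qed.

Lemma edge_point_continuous v w : continuous (edge_point v w).
Proof.
move=> t; apply: ptws_cvg => u.
suff : (1 - s) * (u == v)%:R + s * (u == w)%:R @[s --> t] -->
    (edge_point v w t u : R) by [].
by apply: cvgD; (apply: cvgM; last exact: cvg_cst) => //; apply: cvgB => //;
  exact: cvg_cst.
Qed.

Lemma realization_le1 e x v w : realization R e x -> v != w -> x v + x w <= 1.
Proof.
move=> [x0 <- _] vw; rewrite (bigD1 v)//= (bigD1 w) 1?eq_sym//= addrA lerDl.
by rewrite sumr_ge0.
Qed.

(** A point with positive coordinates at v and w lies inside the edge joining
    them, which gives the second alternative. *)
Lemma realization_edge e x v w : realization R e x -> v != w ->
  x v * x w = 0 \/ x v + x w = 1.
Proof.
move=> [x0 x1 [a [b [_ xab]]]] vw.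
have [xv|xv] := eqVneq (x v) 0; first by left; rewrite xv mul0r.
have [xw|xw] := eqVneq (x w) 0; first by left; rewrite xw mulr0.
right; rewrite -x1 (bigD1 v)//= (bigD1 w) 1?eq_sym//= big1 ?addr0//.
move=> u /andP[uv uw]; apply/eqP; apply: contraNT vw => xu.
move: (xab _ xv) (xab _ xw) (xab _ xu) uv uw.
by do 3![case=> ->]; rewrite ?eqxx.
Qed.

Lemma realization_vertex e x v w : realization R e x -> v != w ->
  x v * x w = 0 -> x v + x w = 1 -> x = vertex v \/ x = vertex w.
Proof.
move=> [x0 x1 _] vw xvw0 xvw1.
have x0' u : u != v -> u != w -> x u = 0.
  move=> uv uw; apply/eqP; rewrite eq_le x0 andbT -(lerD2l 1) addr0.
  rewrite -{1}xvw1 -x1 (bigD1 v)//= (bigD1 w) 1?eq_sym//= (bigD1 u)/=; last by rewrite uv.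
  by rewrite !addrA lerDl sumr_ge0.
have [xv|] := eqVneq (x v) 0; last first.
  move=> xv; have xw : x w = 0.
    by move/eqP: xvw0; rewrite mulf_eq0 (negbTE xv) => /eqP.
  left; apply/funext => u; rewrite /vertex; have [->|uv] := eqVneq u v.
    by rewrite -xvw1 xw addr0.
  by have [->|uw] := eqVneq u w => //; exact: x0'.
right; apply/funext => u; rewrite /vertex; have [->|uw] := eqVneq u w.
  by rewrite -xvw1 xv add0r.
by have [->|uv] := eqVneq u v => //; exact: x0'.
Qed.

Lemma coord_continuous v : continuous (fun x : {ptws V -> R} => x v).
Proof. exact: (@proj_continuous V (fun=> R) v). Qed.

(** For f and g the coordinates at v and w, this function is the one to which
    [edge_exit] applies the intermediate value theorem. *)
Lemma edge_separator_continuous (T : topologicalType) (f g : T -> R) :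
  continuous f -> continuous g ->
  continuous (fun x => f x * g x - (1 - (f x + g x))).
Proof.
move=> cf cg x; apply: cvgB; first by apply: cvgM; [exact: cf|exact: cg].
by apply: cvgB; [exact: cvg_cst|apply: cvgD; [exact: cf|exact: cg]].
Qed.

(** A path that starts on the edge vw and ends outside its interior visits an
    end of the edge. The function x v * x w - (1 - x v - x w) is positive in the
    interior of the edge and nonpositive on the rest of the realization, and it
    vanishes only at v and at w; so a zero of it along the path is the
    required visit. *)
Lemma edge_exit e (h : R -> {ptws V -> R}) v w :
  {within `[0, 1], continuous h} ->
  (forall t, 0 <= t <= 1 -> realization R e (h t)) -> v != w ->
  h 0 v + h 0 w = 1 -> h 1 v * h 1 w = 0 ->
  exists2 t, 0 <= t <= 1 & h t = vertex v \/ h t = vertex w.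
Proof.
move=> hc hK vw h0 h1.
pose G (x : {ptws V -> R}) : R := x v * x w - (1 - (x v + x w)).
have Gc : continuous G.
  by apply: edge_separator_continuous; exact: coord_continuous.
have r0 : 0 <= (0 : R) <= 1 by rewrite lexx ler01.
have r1 : 0 <= (1 : R) <= 1 by rewrite lexx ler01.
have [||c cI Gh] := @IVT R (G \o h) 0 1 0 ler01.
- by apply: within_continuous_comp hc => x _; exact: Gc.
- have G0 : 0 <= G (h 0).
    rewrite /G h0 subrr subr0; case: (hK _ r0) => h00 _ _; exact: mulr_ge0.
  have G1 : G (h 1) <= 0.
    by rewrite /G h1 add0r oppr_le0 subr_ge0 (realization_le1 (hK _ r1) vw).
  by rewrite /= ge_min le_max G0 G1 orbT.
have {}cI : 0 <= c <= 1 by move: cI; rewrite in_itv.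
exists c => //; move: Gh; rewrite /= /G => Gh.
(* Where the function vanishes, each of the two alternatives implies the
   other. *)
have [p0|s1] := realization_edge (hK _ cI) vw.
  apply: (realization_vertex (hK _ cI) vw p0); move: Gh; rewrite p0; lra.
apply: (realization_vertex (hK _ cI) vw _ s1); move: Gh; rewrite s1; lra.
Qed.

End realization.

(** * Cells in cubes and on their boundaries *)

Section point_sets.
Context {R : realType} {n : nat} {V : finType}.
Implicit Types (q : V -> 'rV[R]_n) (p : 'rV[R]_n) (r b : R).

Definition points_within q p r := [set v | (`|q v - p| <= r)%R]%SET.

(** For the sup norm, an open shell of width 2b around the boundary of a
    cube. *)
Definition points_near_sphere q p r b := [set v | (`| `|q v - p| - r| < b)%R]%SET.

End point_sets.

Section cells.
Context {R : realType}.
Implicit Types (s a b : R) (k n : nat).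

(** The index of the interval containing a when [-s, s] is cut into k intervals
    of equal length; the index k is taken only at a = s. *)
Definition bin k s a : 'I_k.+1 := inord (Num.truncn (k%:R * ((a + s) / (2 * s)))).

Lemma eq_bin k s a b : (0 < k)%N -> 0 < s -> `|a| <= s -> `|b| <= s ->
  bin k s a = bin k s b -> `|a - b| < 2 * s / k%:R.
Proof.
move=> k0 s0 as_ bs /(congr1 (@nat_of_ord _)).
have k0' : 0 < k%:R :> R by rewrite ltr0n.
have s20 : 0 < 2 * s by rewrite mulr_gt0.
have ratio c : `|c| <= s -> 0 <= (c + s) / (2 * s) <= 1.
  rewrite ler_norml => /andP[cl cr].
  have cs0 : 0 <= c + s by lra.
  rewrite divr_ge0 ?(ltW s20)//=.
  by rewrite ler_pdivrMr// mul1r; lra.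
have trunc_ltn c : `|c| <= s -> (Num.truncn (k%:R * ((c + s) / (2 * s))) < k.+1)%N.
  move=> /ratio/andP[r0 r1]; rewrite truncn_lt_nat; last exact: mulr_ge0.
  by rewrite (le_lt_trans (y := k%:R))// ?ltr_nat// ler_piMr.
rewrite /bin !inordK ?trunc_ltn// => eqt.
have /truncn_itv/andP[] : 0 <= k%:R * ((a + s) / (2 * s)).
  by case/andP: (ratio _ as_) => ? _; rewrite mulr_ge0.
have /truncn_itv/andP[] : 0 <= k%:R * ((b + s) / (2 * s)).
  by case/andP: (ratio _ bs) => ? _; rewrite mulr_ge0.
rewrite -{}eqt -natr1 => bl bu al au.
have c0 : 0 < 2 * s / k%:R by rewrite divr_gt0.
have -> : a - b = (k%:R * ((a + s) / (2 * s)) - k%:R * ((b + s) / (2 * s))) *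
    (2 * s / k%:R).
  by field; rewrite (lt0r_neq0 s0) (lt0r_neq0 k0').
rewrite normrM (gtr0_norm c0) gtr_pMl//.
move: bl bu al au; set x := k%:R * _; set y := k%:R * _; set z := _%:R.
by move=> bl bu al au; rewrite ltr_norml; apply/andP; split; lra.
Qed.

(** A cell of the boundary of a cube is given by a face, that is a coordinate
    and a sign, and by the bins of the n remaining coordinates. Points of a
    common cell agree in the coordinate defining the face and are within
    2 s / k of each other in the others, so a separated family has at most one
    point in each cell. The exponent n, one less than the dimension of the
    space, is the source of the exponent 1/2 in dimension 3. *)
Lemma card_sphere_separated n k (T : finType) (E : {set T})
    (x : T -> 'rV[R]_n.+1) (p : 'rV[R]_n.+1) s : (0 < k)%N -> 0 < s ->
  (forall i, i \in E -> `|x i - p| = s) ->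
  {in E &, forall i j, `|x i - x j| <= 2 * s / k%:R -> i = j} ->
  (#|E| <= 2 * n.+1 * k.+1 ^ n)%N.
Proof.
move=> k0 s0 xs sep.
pose face i := odflt ord0 [pick j | `|(x i - p) ord0 j| == s].
have faceE i : i \in E -> `|(x i - p) ord0 (face i)| = s.
  move=> iE; rewrite /face; case: pickP => [j /eqP//|] /=.
  have [|j jE] := @norm_coordE R _ (x i - p); first by rewrite xs.
  by move=> /(_ j); rewrite -jE xs// eqxx.
pose cell i := (face i, 0 <= (x i - p) ord0 (face i),
  [ffun l : 'I_n => bin k s ((x i - p) ord0 (lift (face i) l))]).
have cell_inj : {in E &, injective cell}.
  move=> i j iE jE [fE sE /ffunP binE]; apply: sep => //.
  have c0 : 0 <= 2 * s / k%:R by rewrite divr_ge0 ?mulr_ge0// ltW.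
  apply: norm_le_coord => // l.
  have -> : (x i - x j) ord0 l = (x i - p) ord0 l - (x j - p) ord0 l.
    by rewrite !mxE; ring.
  case: (unliftP (face i) l) => [l'|] ->.
    have coord_le u : u \in E -> `|(x u - p) ord0 (lift (face i) l')| <= s.
      by move=> uE; rewrite -(xs u uE) coord_le_norm.
    apply/ltW/eq_bin; rewrite ?coord_le//.
    by have := binE l'; rewrite !ffunE -fE.
  rewrite {2}fE; move: (faceE _ iE) (faceE _ jE); rewrite -fE in sE *.
  case: (leP 0 ((x i - p) ord0 (face i))) sE => [i0|i0] /esym sE.
    by rewrite (ger0_norm i0) (ger0_norm sE) => -> ->; rewrite subrr normr0.
  have {}sE : (x j - p) ord0 (face i) < 0 by rewrite ltNge sE.
  rewrite (ltr0_norm i0) (ltr0_norm sE) => ie je.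
  suff -> : (x i - p) ord0 (face i) - (x j - p) ord0 (face i) = 0.
    by rewrite normr0.
  by lra.
rewrite -(card_in_imset cell_inj); apply: leq_trans (max_card _) _.
by rewrite !card_prod card_bool card_ffun !card_ord (mulnC n.+1).
Qed.

(** Take for r the least radius of a ball centred at one of the points and
    containing M of them. A set of points that lies within less than r of one
    of its members then has fewer than M elements. Cutting [-2r, 2r] into 4
    intervals of length r, hence 5 bins, in each coordinate decomposes the ball
    of radius 2r into 5 ^ n sets of this kind. *)
Lemma doubling_ball n (V : finType) (q : V -> 'rV[R]_n) (M : nat) :
  injective q -> (1 < M <= #|V|)%N ->
  exists v, exists2 r : R, 0 < r &
    (M <= #|points_within q (q v) r|)%N /\
    (#|points_within q (q v) (2 * r)| <= 5 ^ n * M)%N.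
Proof.
move=> q_inj /andP[M1 MV].
pose ball v r := points_within q (q v) r.
have V0 : (0 < #|V|)%N by apply: leq_trans MV; exact: ltnW.
have /card_gt0P[v0 _] := V0.
pose dist v w : R := `|q w - q v|.
pose P vw := (M <= #|ball vw.1 (dist vw.1 vw.2)|)%N.
(* The ball that reaches the point farthest from v0 contains all points, so
   the minimum below is over a nonempty set. *)
case: (@arg_maxP _ _ _ v0 predT (dist v0)) => // w0 _ w0P.
have P0 : P (v0, w0).
  rewrite /P (_ : ball _ _ = [set: V]%SET) ?cardsT//.
  by apply/setP => w; rewrite !inE; exact: w0P.
case: (@arg_minP _ _ _ (v0, w0) P (fun vw => dist vw.1 vw.2) P0) => -[v w].
rewrite /P /= => Pvw minvw.
set r := dist v w in Pvw minvw *.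
have small u (A : {set V}) : {in A, forall u', `|q u' - q u| < r} -> (#|A| < M)%N.
  have [->|[a0 a0A]] := set_0Vmem A; first by rewrite cards0 (ltnW M1).
  move=> Ar.
  case: (@arg_maxP _ _ _ a0 (mem A) (dist u)) => // a aA aP.
  rewrite ltnNge; apply/negP => MA; have := Ar _ aA; rewrite ltNge => /negP; apply.
  apply: (minvw (u, a)); apply: leq_trans MA _; apply: subset_leq_card.
  by apply/fintype.subsetP => b bA; rewrite inE; exact: aP.
(* A ball of radius 0 contains a single point, whereas M > 1. *)
have r0 : 0 < r.
  rewrite lt_def normr_ge0 andbT; apply/negP => /eqP r0.
  have : (#|ball v r| <= 1)%N.
    rewrite -(cards1 v). apply: subset_leq_card. apply/fintype.subsetP => u.
    by rewrite !inE r0 normr_le0 subr_eq0 => /eqP/q_inj ->.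
  by move=> /(leq_trans Pvw); rewrite leqNgt M1.
exists v, r => //; split => //.
have r20 : 0 < 2 * r by rewrite mulr_gt0.
pose cell u := [ffun l : 'I_n => bin 4 (2 * r) ((q u - q v) ord0 l)].
set B := points_within _ _ _.
rewrite -sum1_card (partition_big cell predT)//=.
apply: (@leq_trans (\sum_(c : {ffun 'I_n -> 'I_5}) M)); last first.
  by rewrite sum_nat_const card_ffun !card_ord.
apply: leq_sum => c _; rewrite sum1dep_card.
set Bc := [set _ | _]%SET.
have [->|[u]] := set_0Vmem Bc; first by rewrite cards0.
rewrite inE => /andP[uB /eqP uc].
apply/ltnW/(small u) => u'; rewrite inE => /andP[u'B /eqP u'c].
move: uB u'B; rewrite !inE => uB u'B.
rewrite ltNge; apply/negP => ru.
have [j jE] := norm_coordE (lt_le_trans r0 ru).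
move: ru; rewrite jE leNgt => /negP; apply.
have -> : (q u' - q u) ord0 j = (q u' - q v) ord0 j - (q u - q v) ord0 j.
  by rewrite !mxE; ring.
have -> : r = 2 * (2 * r) / 4%:R by field.
apply: eq_bin => //.
- exact: le_trans (coord_le_norm _ _) u'B.
- exact: le_trans (coord_le_norm _ _) uB.
- by have /ffunP/(_ j) := etrans u'c (esym uc); rewrite !ffunE.
Qed.

End cells.

(** * Edges of an embedded graph *)

Section embedded_graph.
Context {R : realType} {V : finType} {n : nat}.
Variables (e : rel V) (f : {ptws V -> R} -> 'rV[R]_n.+1).
Hypothesis fP : embedding (realization R e) f.

Let K := f @` realization R e.

Lemma vertex_image_inj : injective (f \o vertex).
Proof.
move=> v w /= fvw; case: fP => _ [g _ fK]; apply: (@vertex_inj R V).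
by rewrite -(fK (vertex v)) ?fvw ?fK// inE; exact: vertex_realization.
Qed.

Lemma edge_crosses_sphere (p : 'rV[R]_n.+1) s v w : e v w ->
  `|f (vertex v) - p| <= s -> s < `|f (vertex w) - p| ->
  exists2 t, 0 <= t <= 1 & `|f (edge_point v w t) - p| = s.
Proof.
move=> vw vs sw.
have fc : {within `[0, 1], continuous (f \o edge_point v w)}.
  apply: within_continuousT (fP.1).
    by apply: continuous_subspaceT; exact: edge_point_continuous.
  by move=> t; rewrite /= in_itv /=; apply: edge_point_realization; right.
have distc : {in (f \o edge_point v w) @` `[0, 1],
    continuous (fun x : 'rV[R]_n.+1 => `|x - p|)}.
  by move=> x _; exact: cvg_norm (cvgB cvg_id (cvg_cst p)).
have [||t tI ts] := @IVT R (fun t => `|f (edge_point v w t) - p|) 0 1 s ler01.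
- exact: within_continuous_comp distc fc.
- by rewrite edge_point0 edge_point1 ge_min le_max vs (ltW sw) orbT.
by exists t => //; move: tI; rewrite in_itv.
Qed.

(** If the image of a point x of the edge vw is close to the image of a point y
    outside the interior of the edge, then it is close to the image of v or of w,
    because a short path from x to y passes through one of them. *)
Lemma near_endpoint (D b : R) (x y : {ptws V -> R}) v w : v != w ->
  (distortion K <= D%:E)%E -> realization R e x -> realization R e y ->
  x v + x w = 1 -> y v * y w = 0 ->
  0 < b -> D * euclidean_dist (f x) (f y) < b ->
  exists2 u, u = v \/ u = w & `|f (vertex u) - f x| < b.
Proof.
move=> vw KD Kx Ky xvw yvw b0 Db.
have [_ [g gc fK]] := fP.
(* The distortion says nothing about equal points; but then x = y is an end of
   the edge. *)
have [fxy|fxy] := pselect (f x = f y).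
  have xy : x = y by rewrite -(fK x) ?fxy ?fK// inE.
  rewrite -xy in yvw.
  by case: (realization_vertex Kx vw yvw xvw) => xE; [exists v|exists w];
    rewrite -?xE ?subrr ?normr0//; [left|right].
have [||h [hc h0 h1 hK] hb] := short_path KD _ _ fxy Db.
- by exists x.
- by exists y.
have [|||||t tI hvw] := @edge_exit R V e (g \o h) v w.
- by apply: within_continuousT hc _ gc => t; rewrite /= in_itv /=; exact: hK.
- by move=> t /hK[z Kz zE]; rewrite /= -zE fK ?inE.
- exact: vw.
- by rewrite /= h0 fK ?inE.
- by rewrite /= h1 fK ?inE.
have [z Kz zE] := hK _ tI.
have ghz : (g \o h) t = z by rewrite /= -zE fK ?inE.
rewrite {}ghz in hvw; have := hb _ tI; rewrite -zE.
by case: hvw => -> ?; [exists v|exists w] => //; [left|right].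
Qed.

End embedded_graph.

(** * Counting edges and vertices *)

Section counting.
Context {V : finType}.
Variables (e : rel V) (d : nat).
Hypothesis degd : forall v, (degree e v <= d)%N.

Lemma card_edges_from (A : {set V}) :
  (#|[set p : V * V | (p.1 \in A) && e p.1 p.2]%SET| <= d * #|A|)%N.
Proof.
rewrite -sum1dep_card -(pair_big_dep (mem A) (fun v w => e v w) (fun _ _ => 1%N)) /=.
rewrite mulnC -sum_nat_const; apply: leq_sum => v _.
by rewrite sum1_card; exact: degd.
Qed.

Lemma card_edges_touching (A : {set V}) : symmetric e ->
  (#|[set p : V * V | e p.1 p.2 && ((p.1 \in A) || (p.2 \in A))]%SET|
     <= 2 * d * #|A|)%N.
Proof.
move=> esym; set E := [set p | (p.1 \in A) && e p.1 p.2]%SET.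
pose sw (p : V * V) := (p.2, p.1).
have sw_inj : injective sw by move=> [a b] [a' b'] [-> ->].
apply: (@leq_trans #|E :|: sw @: E|%SET).
  apply: subset_leq_card; apply/fintype.subsetP => -[a b].
  rewrite !inE /= => /andP[ab /orP[aA|bA]]; first by rewrite aA ab.
  apply/orP; right; apply/imsetP; exists (b, a) => //.
  by rewrite inE /= bA esym.
apply: leq_trans (leq_card_setU _ _) _.
by rewrite card_imset// addnn -mul2n -mulnA leq_mul2l /= card_edges_from.
Qed.

Lemma sum_card_disjoint (J : finType) (A : J -> {set V}) :
  (forall i j v, v \in A i -> v \in A j -> i = j) ->
  (\sum_i #|A i| <= #|V|)%N.
Proof.
move=> disj.
rewrite (eq_bigr (fun i => \sum_(v in A i) 1)%N); last first.
  by move=> i _; rewrite sum1_card.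
rewrite (pair_big_dep predT (fun i v => v \in A i) (fun _ _ => 1%N))/= sum1dep_card.
rewrite -(@card_in_imset _ _ snd) ?max_card// => -[i v] [j w].
by rewrite !inE /= => vi wj vw; rewrite -vw in wj *; rewrite (disj i j v).
Qed.

End counting.

(** The edges leaving the cube of half-side s are counted in two parts. Those
    without an end near the boundary of the cube cross it in points that are
    2 s / k separated, since otherwise [near_endpoint] would provide such an
    end; their number is bounded by that of the cells. The others have an end
    in the shell and are counted by degrees. *)
Lemma card_boundary_le_annulus (R : realType) (V : finType) n (e : rel V)
    (f : {ptws V -> R} -> 'rV[R]_n.+1) (d k : nat) (D b s : R)
    (p : 'rV[R]_n.+1) :
  symmetric e -> (forall v, (degree e v <= d)%N) ->
  embedding (realization R e) f ->
  (distortion (f @` realization R e) <= D%:E)%E ->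
  (0 < k)%N -> 0 < s -> 0 <= D -> 0 < b ->
  D * (n.+1%:R * (2 * s / k%:R)) < b ->
  (#|edge_boundary e (points_within (f \o vertex) p s)| <=
     2 * n.+1 * k.+1 ^ n +
     2 * d * #|points_near_sphere (f \o vertex) p s b|)%N.
Proof.
move=> esym degd fP KD k0 s0 D0 b0 Db.
set S := points_within _ _ _; set A := points_near_sphere _ _ _ _.
pose crosses (q : V * V) t := 0 <= t <= 1 /\ `|f (edge_point q.1 q.2 t) - p| = s.
have [t tP] : {t : V * V -> R & forall q, q \in edge_boundary e S -> crosses q (t q)}.
  apply: (@choice _ _ (fun q t => q \in edge_boundary e S -> crosses q t)) => q.
  have [qS|qS] := boolP (q \in edge_boundary e S); last by exists 0.
  move: (qS); rewrite !inE => /and3P[q1 q2 qe].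
  have [|t tI ts] := edge_crosses_sphere fP qe q1; last by exists t.
  by rewrite ltNge.
pose x q := edge_point q.1 q.2 (t q) : {ptws V -> R}.
pose far := [set q in edge_boundary e S | (q.1 \notin A) && (q.2 \notin A)]%SET.
have far_le : (#|far| <= 2 * n.+1 * k.+1 ^ n)%N.
  apply: (card_sphere_separated (x := f \o x) (p := p) k0 s0).
    by move=> q; rewrite inE => /andP[/tP[]].
  move=> q q'; rewrite ![_ \in far]finset.in_set.
  move=> /andP[qB /andP[q1 q2]] /andP[q'B _] close.
  apply/eqP; apply: contraT => qq'.
  have [tI ts] := tP q qB; have [t'I ts'] := tP q' q'B.
  move: (qB) (q'B); rewrite !inE => /and3P[q1S q2S qe] /and3P[q1'S q2'S qe'].
  have q12 : q.1 != q.2 by apply: contraNneq q2S => <-.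
  have [||||||u uq xu] := @near_endpoint R V n e f fP D b (x q) (x q') q.1 q.2 q12 KD.
  - by apply: edge_point_realization tI; right.
  - by apply: edge_point_realization t'I; right.
  - rewrite /x /edge_point !eqxx (negbTE q12) eq_sym (negbTE q12) !mulr1 !mulr0.
    by rewrite addr0 add0r subrK.
  (* Both edges are oriented outwards, so distinct edges differ at their inner
     or at their outer end, and that end of q is no end of q'. *)
  - rewrite /x /edge_point.
    have -> : (q.1 == q'.2) = false by apply: contraNF q2'S => /eqP <-.
    have -> : (q.2 == q'.1) = false by apply: contraNF q2S => /eqP ->.
    case: (eqVneq q.1 q'.1) => [q1E|_]; last by rewrite !mulr0 addr0 mul0r.
    case: (eqVneq q.2 q'.2) => [q2E|_]; last by rewrite !mulr0 !addr0 mulr0.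
    by move: qq'; rewrite -pair_eqE /= /pair_eq q1E q2E !eqxx.
  - exact: b0.
  - apply: le_lt_trans Db; rewrite ler_wpM2l//.
    by apply: le_trans (euclid_le_norm _ _) _; rewrite ler_wpM2l.
  have : u \in A.
    rewrite inE -[X in _ - X]ts; apply: le_lt_trans xu.
    apply: le_trans (ler_dist_dist _ _) _.
    by rewrite opprB addrA subrK.
  by case: uq => ->; rewrite ?(negbTE q1) ?(negbTE q2).
apply: leq_trans (leq_add far_le (card_edges_touching degd A esym)).
apply: leq_trans (leq_card_setU _ _); apply: subset_leq_card.
apply/fintype.subsetP => q qB; rewrite finset.in_setU; apply/orP.
have [qA|qA] := boolP ((q.1 \in A) || (q.2 \in A)); [right|left].
  move: qB; rewrite finset.in_set => /and3P[_ _ qe].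
  by rewrite finset.in_set qe qA.
by rewrite finset.in_set qB -negb_or.
Qed.

(** * The lower bound for expanders *)

Lemma shell_radius_bounds (R : realType) (r b : R) (J j : nat) : 0 < b ->
  r = 2 * J%:R * b -> (j < J)%N -> r < r + (2 * j%:R + 1) * b < 2 * r.
Proof.
move=> b0 rE jJ; apply/andP; split.
  by rewrite ltrDl mulr_gt0// ltr_pwDr// mulr_ge0.
rewrite [2 * r]mulr_natl mulr2n ltrD2l rE ltr_pM2r//.
have : (j.+1%:R : R) <= J%:R by rewrite ler_nat.
by rewrite -natr1; lra.
Qed.

Lemma shells_disjoint (R : realType) n (V : finType) (q : V -> 'rV[R]_n)
    (p : 'rV[R]_n) (r b : R) (i j : nat) v : 0 < b ->
  v \in points_near_sphere q p (r + (2 * i%:R + 1) * b) b ->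
  v \in points_near_sphere q p (r + (2 * j%:R + 1) * b) b -> i = j.
Proof.
move=> b0; rewrite !inE; set x := `|q v - p|; move=> vi vj.
have b20 : 0 < 2 * b by rewrite mulr_gt0.
have : `|(i%:R - j%:R) * (2 * b)| < 2 * b.
  move: vi vj; rewrite !ltr_norml => /andP[i1 i2] /andP[j1 j2].
  by apply/andP; split; lra.
rewrite normrM (gtr0_norm b20) gtr_pMl// ltr_norml => /andP[ij ji].
have ij' : (i < j.+1)%N by rewrite -(ltr_nat R) -natr1; lra.
have ji' : (j < i.+1)%N by rewrite -(ltr_nat R) -natr1; lra.
by apply/eqP; rewrite eqn_leq -ltnS ij' -ltnS ji'.
Qed.

(** The argument with all its parameters: the ball of radius r contains about
    N / 250 vertices, so that of radius 2r contains at most 5 ^ 3 N / 250, and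
    the annulus between them is divided into J shells of width 2b = r / J. The
    three inequalities say in turn that the cells are at most half as many as
    the edges leaving a ball, of which there are alpha N / 500; that J shells
    with the resulting alpha N / (2000 d) vertices each are too many; and that a
    path between points of a common cell is shorter than b. *)
Lemma distortion_gt_of_expander (R : realType) (V : finType) (e : rel V) (alpha D : R)
    (d k J : nat) (f : {ptws V -> R} -> 'rV[R]_3) :
  symmetric e -> (forall v, (degree e v <= d)%N) ->
  expander alpha e -> 0 <= alpha ->
  embedding (realization R e) f ->
  500 <= #|V|%:R :> R -> (0 < k)%N -> (0 < J)%N ->
  6 * k.+1%:R ^+ 2 <= alpha * #|V|%:R / 1000 ->
  2000 * d%:R < alpha * J%:R ->
  24 * J%:R * D <= k%:R ->
  (D%:E < distortion (f @` realization R e))%E.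
Proof.
move=> esym degd expe alpha0 fP V500 k0 J0 kN Jd Dk.
rewrite ltNge; apply/negP => KD.
set N := #|V|%:R in kN *.
pose M := Num.truncn (N / 250).
have N250 : 2 <= N / 250 by move: V500; rewrite -/N; lra.
have N250' : 0 <= N / 250 by lra.
have /andP[] := truncn_itv N250'; rewrite -/M -[M.+1%:R]natr1 => MN NM.
have M2 : (2 <= M)%N by rewrite truncn_ge_nat.
have MV : (M <= #|V|)%N by rewrite -(ler_nat R) -/N; lra.
have [|v0 [r r0 []]] := doubling_ball (vertex_image_inj fP) (M := M).
  by rewrite M2.
set q := f \o vertex; set p := q v0; move=> Mr r2M.
pose b : R := r / (2 * J%:R).
pose s (j : 'I_J) : R := r + (2 * j%:R + 1) * b.
have J0' : 0 < J%:R :> R by rewrite ltr0n.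
have k0' : 0 < k%:R :> R by rewrite ltr0n.
have b0 : 0 < b by rewrite divr_gt0// mulr_gt0.
have rE : r = 2 * J%:R * b by rewrite /b; field; exact: lt0r_neq0.
have rs j : r < s j by case/andP: (shell_radius_bounds b0 rE (ltn_ord j)).
have sr j : s j < 2 * r by case/andP: (shell_radius_bounds b0 rE (ltn_ord j)).
have D1 : 1 <= D.
  by rewrite -lee_fin; exact: le_trans (distortion_ge1 _) KD.
pose A j := points_near_sphere q p (s j) b.
have disj i j v : v \in A i -> v \in A j -> i = j.
  by move=> vi vj; apply: val_inj; exact: shells_disjoint vi vj.
have A_ge j : alpha * N / 1000 <= 2 * d%:R * #|A j|%:R.
  have sj0 : 0 < s j by exact: lt_trans (rs j).
  have bnd : D * (3%:R * (2 * s j / k%:R)) < b.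
    have D0 : 0 < D by exact: lt_le_trans D1.
    rewrite (_ : D * _ = 6 * D / k%:R * s j); last by field; exact: lt0r_neq0.
    apply: (@lt_le_trans _ _ (6 * D / k%:R * (2 * r))).
      by rewrite ltr_pM2l// divr_gt0// mulr_gt0.
    rewrite (_ : _ * _ = 24 * J%:R * D * (b / k%:R)); last first.
      by rewrite rE; field; exact: lt0r_neq0.
    apply: (@le_trans _ _ (k%:R * (b / k%:R))).
      by rewrite ler_wpM2r// ltW// divr_gt0.
    by rewrite mulrCA divff ?mulr1// lt0r_neq0.
  have := card_boundary_le_annulus p esym degd fP KD k0 sj0
    (le_trans ler01 D1) b0 bnd.
  rewrite -(ler_nat R) natrD natrM natrX !natrM -/(A j) -/q.
  set S := points_within _ _ _ => bd.
  have MS : (M <= #|S|)%N.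
    apply: leq_trans Mr _; apply: subset_leq_card; apply/fintype.subsetP => v.
    by rewrite !inE => /le_trans; apply; exact: ltW.
  have SM : (#|S| <= 5 ^ 3 * M)%N.
    apply: leq_trans r2M; apply: subset_leq_card; apply/fintype.subsetP => v.
    by rewrite !inE => /le_trans; apply; exact: ltW.
  have : alpha * #|S|%:R <= #|edge_boundary e S|%:R.
    apply: expe; move: SM; rewrite -(ler_nat R) natrM natrX -/N; lra.
  have : alpha * (N / 500) <= alpha * #|S|%:R.
    by rewrite ler_wpM2l//; move: MS; rewrite -(ler_nat R); lra.
  rewrite -/N; lra.
have : (\sum_j #|A j| <= #|V|)%N by exact: sum_card_disjoint disj.
rewrite -(ler_nat R) natr_sum => sumA.
have : \sum_(j < J) alpha * N / 1000 <= \sum_(j < J) 2 * d%:R * #|A j|%:R.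
  by apply: ler_sum => j _; exact: A_ge.
rewrite sumr_const card_ord -[leLHS]mulr_natl -mulr_sumr => JA.
have N0 : 0 < N by move: N250; lra.
have : 2 * d%:R * \sum_(j < J) #|A j|%:R <= 2 * d%:R * N.
  by rewrite ler_wpM2l// mulr_ge0.
have : 2000 * d%:R * N < alpha * J%:R * N by rewrite ltr_pM2r.
lra.
Qed.

Theorem theorem6p1 (R : realType) (alpha : R) (d : nat) :
  0 < alpha -> (0 < d)%N ->
  exists2 C : R, 0 < C &
    forall (V : finType) (e : rel V),
      symmetric e -> irreflexive e ->
      expander alpha e ->
      (forall v : V, (degree e v <= d)%N) ->
      ((C * Num.sqrt #|V|%:R)%:E < intrinsic_distortion 3 (realization R e))%E.
Proof.
move=> alpha0 _.
(* J exceeds 2000 d / alpha, as the number of shells must. About beta * sqrt N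
   cells per coordinate are used, so that 6 (k + 1)^2 <= alpha N / 1000, and the
   first term in C makes paths short enough; the second one settles N < 500,
   since 500 < 23^2. *)
pose J := (Num.truncn (2000 * d%:R / alpha)).+1.
have Jd : 2000 * d%:R < alpha * J%:R.
  by rewrite [alpha * _]mulrC -ltr_pdivrMr//; exact: truncnS_gt.
pose beta := Num.sqrt (alpha / 6000).
have beta0 : 0 < beta by rewrite sqrtr_gt0; lra.
have J0 : 0 < J%:R :> R by rewrite ltr0n.
pose C := Num.min (beta / (192 * J%:R)) (1 / 23).
have J192 : 0 < 192 * J%:R :> R by lra.
have C0 : 0 < C by rewrite lt_min divr_gt0//=; lra.
exists C => // V e esym _ expe degd.
set N := #|V|%:R.
have N0 : 0 <= Num.sqrt N by exact: sqrtr_ge0.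
have CJ : 192 * J%:R * C <= beta.
  have : C <= beta / (192 * J%:R) by rewrite ge_min lexx.
  by rewrite ler_pdivlMr// mulrC.
have C23 : C <= 1 / 23 by rewrite ge_min lexx orbT.
have ge1 : (1 <= intrinsic_distortion 3 (realization R e) :> \bar R)%E.
  by apply: le_ereal_inf_tmp => _ [f _ <-]; exact: distortion_ge1.
have [small|V500] := ltP N 500.
  apply: lt_le_trans ge1; rewrite lte_fin.
  have : Num.sqrt N < 23.
    rewrite -[ltRHS]ger0_norm// -sqrtr_sqr ltr_sqrt// expr2.
    by apply: lt_le_trans small _; lra.
  nra.
(* Below this bound there is no room for even one cell per coordinate, and the
   distortion is at least 1 anyway. *)
have [xs|x2] := ltP (beta * Num.sqrt N) 2.
  apply: lt_le_trans ge1; rewrite lte_fin.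
  have J1 : 1 <= J%:R :> R by rewrite ler1n.
  have : 192 * C <= beta by nra.
  nra.
rewrite ltNge; apply/negP => le_dist.
have sN0 : 0 < Num.sqrt N by rewrite sqrtr_gt0; lra.
have /ereal_inf_lt[_ [f fP <-] fD] :
    (intrinsic_distortion 3 (realization R e) < (2 * (C * Num.sqrt N))%:E)%E.
  by apply: le_lt_trans le_dist _; rewrite lte_fin ltr_pMl ?mulr_gt0// ltr1n.
(* With k = m - 1 there are m = k + 1 bins. *)
pose m := Num.truncn (beta * Num.sqrt N).
have bN0 : 0 <= beta * Num.sqrt N by exact: le_trans x2.
have /andP[mx xm] := truncn_itv bN0.
have m2 : (2 <= m)%N by rewrite truncn_ge_nat.
have mE : m.-1.+1 = m by rewrite prednK// (leq_trans _ m2).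
have m1E : (m.-1%:R : R) = m%:R - 1 by rewrite -[in RHS]mE -natr1 addrK.
have m2' : 2 <= m%:R :> R by rewrite ler_nat.
suff : ((2 * (C * Num.sqrt N))%:E < distortion (f @` realization R e))%E.
  by rewrite ltNge (ltW fD).
apply: (@distortion_gt_of_expander R V e alpha _ d m.-1 J) => //.
- exact: ltW.
- by rewrite -subn1 subn_gt0.
- rewrite mE -/N.
  have : m%:R ^+ 2 <= (beta * Num.sqrt N) ^+ 2.
    by rewrite lerXn2r ?nnegrE.
  have a0 : 0 <= alpha / 6000 by lra.
  rewrite exprMn (sqr_sqrtr a0) (sqr_sqrtr (ler0n _ _)).
  lra.
- rewrite m1E; move: xm; rewrite -natr1 -/m => xm.
  have : 192 * J%:R * C * Num.sqrt N <= beta * Num.sqrt N by rewrite ler_wpM2r.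
  lra.
Qed.
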